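(* Let $k$ be a positive integer. For integers $q\ge 2$ define \[ F_k(q) = \min \{ |kA| : A\subset \mathbb{Z}_q,\ A-A = \mathbb{Z}_q \}, \] \[ G_k(q) = \min \{ |kA| : A\subset \mathbb{Z} \text{ finite},\ A-A \supset \{a+1, \ldots, a+q \} \text{ for some integer } a \}, \] \[ H_k(q) = \min \{ |kA| : A\subset \mathbb{Z} \text{ finite},\ |A-A| \geq q \}, \] and put $\alpha_k = \inf_{q\geq 2} \frac{\log G_k(q)}{\log q}$. Then the limits \[ \lim_{q\to\infty} \frac{\log F_k(q)}{\log q},\quad \lim_{q\to\infty} \frac{\log G_k(q)}{\log q},\quad \lim_{q\to\infty} \frac{\log H_k(q)}{\log q} \] exist, and \[ \lim_{q\to\infty} \frac{\log F_k(q)}{\log q} = \lim_{q\to\infty} \frac{\log G_k(q)}{\log q} = \lim_{q\to\infty} \frac{\log H_k(q)}{\log q} = \inf_{q\geq 2} \frac{\log H_k(q)}{\log q} = \alpha_k. \]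
   Context: $\mathbb{Z}_q$ denotes the group of residues modulo $q$. For a set $A$ in an abelian group, $kA = A+\cdots+A$ ($k$ times) is the set of all sums of $k$ (not necessarily distinct) elements of $A$, and $A-A=\{a-b: a,b\in A\}$. *)

(* Defs.v *)
From HB Require Import structures.
From mathcomp Require Import all_boot all_order all_algebra finmap.
From mathcomp Require Import all_classical all_reals all_analysis.
Set Implicit Arguments.
Unset Strict Implicit.
Unset Printing Implicit Defensive.
Import Order.TTheory GRing.Theory Num.Theory.
Import numFieldNormedType.Exports.
Local Open Scope fset_scope.
Local Open Scope classical_set_scope.
Local Open Scope ring_scope.

Definition sumset (V : zmodType) (A B : {fset V}) : {fset V} :=
  [fset a + b | a in A, b in B].

Definition diffset (V : zmodType) (A B : {fset V}) : {fset V} :=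
  [fset a - b | a in A, b in B].

Definition ksumset (V : zmodType) (k : nat) (A : {fset V}) : {fset V} :=
  iter k (sumset A) [fset 0].

Lemma ksumsetP (V : zmodType) (k : nat) (A : {fset V}) (x : V) :
  x \in ksumset k A <->
  exists2 f : 'I_k -> V, (forall i, f i \in A) & x = \sum_(i < k) f i.
Proof.
elim: k x => [|k IH] x /=; split.
- by rewrite inE => /eqP ->; exists (fun=> 0) => [[]//|]; rewrite big_ord0.
- by case=> f _ ->; rewrite big_ord0 inE.
- case/imfset2P => a aA [b /IH[f fA ->] ->].
  exists (fun i => if unlift ord0 i is Some j then f j else a) => [i|].
    by case: unliftP => [j _|_].
  rewrite big_ord_recl unlift_none; congr (_ + _).
  by apply: eq_bigr => i _; rewrite liftK.
- case=> f fA ->; rewrite big_ord_recl.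
  apply/imfset2P; exists (f ord0); first exact: fA.
  exists (\sum_(i < k) f (lift ord0 i)) => //.
  by apply/IH; exists (fun i => f (lift ord0 i)).
Qed.

(* 0 is a dummy value for the empty set, never used here by F_nonempty,
   G_nonempty and H_nonempty. *)
Definition minset (S : set nat) : nat :=
  if pselect (exists n, `[< S n >]) is left exS then ex_minn exS else 0%N.

Lemma minsetP (S : set nat) : S !=set0 ->
  S (minset S) /\ (forall n, S n -> (minset S <= n)%N).
Proof.
case=> n Sn; rewrite /minset; case: pselect => [exS|nS]; last first.
  by case: nS; exists n; apply/asboolP.
case: ex_minnP => m /asboolP Sm mmin; split=> // p Sp.
by apply: mmin; apply/asboolP.
Qed.

(* 'Z_q is the group of residues modulo q only for q >= 2; the values at
   q = 0, 1 are irrelevant. *)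
Definition F (k q : nat) : nat :=
  minset [set #|` ksumset k A| | A in
    [set A : {fset 'Z_q} | forall x : 'Z_q, x \in diffset A A]].

Definition G (k q : nat) : nat :=
  minset [set #|` ksumset k A| | A in
    [set A : {fset int} | exists a : int, forall x : int,
       a + 1 <= x <= a + q%:Z -> x \in diffset A A]].

Definition H (k q : nat) : nat :=
  minset [set #|` ksumset k A| | A in
    [set A : {fset int} | (q <= #|` diffset A A|)%N]].

Lemma F_nonempty (q : nat) :
  exists A : {fset 'Z_q}, forall x : 'Z_q, x \in diffset A A.
Proof.
exists [fset x | x in 'Z_q]%fset => x.
by apply/imfset2P; exists x; rewrite ?inE //; exists 0; rewrite ?inE ?subr0.
Qed.

Lemma G_nonempty (q : nat) :
  exists A : {fset int}, exists a : int, forall x : int,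
    a + 1 <= x <= a + q%:Z -> x \in diffset A A.
Proof.
exists [fset (Posz i) | i in iota 0 q.+1]%fset, 0 => x.
rewrite !add0r; case: x => // n /andP[_ nq].
apply/imfset2P; exists (Posz n).
  by apply/imfsetP; exists n => //; rewrite (mem_iota 0 q.+1).
exists 0; last by rewrite subr0.
by apply/imfsetP; exists 0%N.
Qed.

Lemma H_nonempty (q : nat) :
  exists A : {fset int}, (q <= #|` diffset A A|)%N.
Proof.
have [A [a sA]] := G_nonempty q; exists A.
pose B := [fset (a + 1 + Posz i)%R | i in iota 0 q]%fset.
have cB : #|` B| = q.
  rewrite card_in_imfset /=; last by move=> i j _ _ /addrI[].
  by rewrite undup_id ?iota_uniq // size_iota.
rewrite -{1}cB; apply: fsubset_leq_card; apply/fsubsetP => x /imfsetP[i /=].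
rewrite mem_iota add0n => iq ->; apply: sA.
by rewrite lerDl -addrA lerD2l.
Qed.

Definition logratio (R : realType) (f : nat -> nat) (q : nat) : R :=
  ln (f q)%:R / ln q%:R.

Definition inflogratio (R : realType) (f : nat -> nat) : R :=
  inf [set logratio R f q | q in [set q : nat | (2 <= q)%N]].

(* The library's inf is 0 by default on sets without infimum; this default
   is never used here. *)
Lemma has_inf_logratio (R : realType) (f : nat -> nat) :
  has_inf [set logratio R f q | q in [set q : nat | (2 <= q)%N]].
Proof.
have ln_nat_ge0 n : 0 <= ln (n%:R : R).
  by case: n => [|n]; [rewrite ln0 | rewrite ln_ge0 // ler1n].
split; first by exists (logratio R f 2), 2%N.
by exists 0 => _ [q _ <-]; rewrite divr_ge0.
Qed.

Definition alpha (R : realType) (k : nat) : R := inflogratio R (G k).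

(* Main.v *)
Require Import Defs.
From mathcomp Require Import all_boot all_order all_algebra finmap.
From mathcomp Require Import all_classical all_reals all_analysis.
From mathcomp Require Import zify ring lra.
Import Order.TTheory GRing.Theory Num.Theory.
Import numFieldNormedType.Exports.
Local Open Scope classical_set_scope.
Local Open Scope ring_scope.

(* For every q >= 2 one has F q <= G q <= (2k+1) F q: reduce modulo q, and
   conversely lift A to {a, a + q | a in A}.  G and H are submultiplicative
   (consider A + c B) and H <= G, so everything follows from a bound of G by H
   with polylogarithmic loss, applied along powers of q.

   Let |A - A| >= q, m = 6 q, P a large prime, and f x = floor (t x m / P).
   Since f is additive up to an error in {0, 1}, taking f-images multiplies
   |kA| by at most k + 1.  Averaging over t mod P, the number of collisions of f
   modulo m among q elements of A - A is at most q / 2 for some t, so f (A - A)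
   covers at least m / 12 residues modulo m.  Greedily, O(log m) translates of
   this set cover Z_m; adding the translation vectors to f A (and correcting the
   rounding error) gives a set C with C - C = Z_m and |kC| = O(log m)^k |kA|. *)

(** * Cardinalities of images and iterated sumsets *)

Lemma card_fset_leq_size {T : choiceType} (A : {fset T}) (s : seq T) :
  {subset A <= s} -> (#|` A| <= size s)%N.
Proof. exact: uniq_leq_size (fset_uniq A). Qed.

Lemma card_imfset2_leq {T1 T2 T : choiceType} (f : T1 -> T2 -> T)
    (A : {fset T1}) (B : {fset T2}) :
  (#|` [fset f a b | a in A, b in B]%fset| <= #|` A| * #|` B|)%N.
Proof.
rewrite -(size_allpairs f A B); apply: card_fset_leq_size => x.
by case/imfset2P => a aA [b bB ->]; apply: allpairs_f.
Qed.

Section Sumsets.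
Context {V W : zmodType}.

Lemma ksumset_morph (f : V -> W) (k : nat) (A : {fset V}) :
  f 0 = 0 -> {morph f : x y / x + y} ->
  (ksumset k [fset f a | a in A] `<=` [fset f x | x in ksumset k A])%fset.
Proof.
move=> f0 fD; elim: k => [|k IH]; apply/fsubsetP => y /=.
  rewrite inE => /eqP ->; apply/imfsetP; exists 0; rewrite ?f0 //.
  by rewrite inE.
case/imfset2P => _ /imfsetP[a /= aA ->] [y' /(fsubsetP IH)/imfsetP[x /= xA ->] ->].
apply/imfsetP; exists (a + x); rewrite ?fD //=.
by apply/imfset2P; exists a => //; exists x.
Qed.

Lemma card_ksumset_morph (f : V -> W) (k : nat) (A : {fset V}) :
  f 0 = 0 -> {morph f : x y / x + y} ->
  (#|` ksumset k [fset f a | a in A]%fset| <= #|` ksumset k A|)%N.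
Proof.
move=> f0 fD.
apply: leq_trans (fsubset_leq_card (ksumset_morph f k A f0 fD)) _.
exact: leq_imfset_card.
Qed.

Lemma ksumset_sumset (k : nat) (A B : {fset V}) :
  (ksumset k (sumset A B) `<=` sumset (ksumset k A) (ksumset k B))%fset.
Proof.
elim: k => [|k IH]; apply/fsubsetP => y /=.
  rewrite inE => /eqP ->; apply/imfset2P; exists 0; first by rewrite inE.
  by exists 0; rewrite ?inE ?addr0.
case/imfset2P => _ /imfset2P[a aA [b bB ->]].
case=> _ /(fsubsetP IH)/imfset2P[x xA [y' yB ->]] ->.
apply/imfset2P; exists (a + x); first by apply/imfset2P; exists a => //; exists x.
exists (b + y'); last by rewrite addrACA.
by apply/imfset2P; exists b => //; exists y'.
Qed.

Lemma card_ksumset_sumset (k : nat) (A B : {fset V}) :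
  (#|` ksumset k (sumset A B)| <= #|` ksumset k A| * #|` ksumset k B|)%N.
Proof.
exact: leq_trans (fsubset_leq_card (ksumset_sumset k A B)) (card_imfset2_leq _ _ _).
Qed.

Lemma card_ksumset_leq (k : nat) (A : {fset V}) :
  (#|` ksumset k A| <= #|` A| ^ k)%N.
Proof.
elim: k => [|k IH] /=; first by rewrite cardfs1.
by rewrite expnS (leq_trans (card_imfset2_leq _ _ _)) // leq_mul2l IH orbT.
Qed.

End Sumsets.

(** * Extremal sets, comparisons between [F], [G] and [H], and submultiplicativity *)

Lemma minset_image {T : Type} (P : set T) (f : T -> nat) : P !=set0 ->
  exists2 x, P x & Defs.minset [set f x | x in P] = f x.
Proof.
case=> x Px; have [|[y Py <-] _] := @Defs.minsetP [set f x | x in P]; last by exists y.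
by exists (f x), x.
Qed.

Lemma minset_image_le {T : Type} (P : set T) (f : T -> nat) (x : T) :
  P x -> (Defs.minset [set f x | x in P] <= f x)%N.
Proof.
move=> Px; have [|_] := @Defs.minsetP [set f x | x in P]; first by exists (f x), x.
by apply; exists x.
Qed.

Definition covers_interval (q : nat) (A : {fset int}) : Prop :=
  exists a : int, forall x : int,
    a + 1 <= x <= a + q%:Z -> x \in diffset A A.

Section Comparisons.
Variable k : nat.

Lemma F_attained (q : nat) : exists2 A : {fset 'Z_q},
  (forall x, x \in diffset A A) & F k q = #|` ksumset k A|.
Proof. exact: (minset_image _ _ (F_nonempty q)). Qed.

Lemma F_le (q : nat) (A : {fset 'Z_q}) :
  (forall x, x \in diffset A A) -> (F k q <= #|` ksumset k A|)%N.
Proof. by move=> hA; apply: (minset_image_le _ (fun A => #|` ksumset k A|)). Qed.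

Lemma G_attained (q : nat) : exists2 A : {fset int},
  covers_interval q A & G k q = #|` ksumset k A|.
Proof. exact: (minset_image _ _ (G_nonempty q)). Qed.

Lemma G_le (q : nat) (A : {fset int}) :
  covers_interval q A -> (G k q <= #|` ksumset k A|)%N.
Proof. by move=> hA; apply: (minset_image_le _ (fun A => #|` ksumset k A|)). Qed.

Lemma H_attained (q : nat) : exists2 A : {fset int},
  (q <= #|` diffset A A|)%N & H k q = #|` ksumset k A|.
Proof. exact: (minset_image _ _ (H_nonempty q)). Qed.

Lemma H_le (q : nat) (A : {fset int}) :
  (q <= #|` diffset A A|)%N -> (H k q <= #|` ksumset k A|)%N.
Proof. by move=> hA; apply: (minset_image_le _ (fun A => #|` ksumset k A|)). Qed.

Lemma H_le_G (q : nat) : (H k q <= G k q)%N.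
Proof.
have [A [a hA] ->] := G_attained q; apply: H_le.
pose B := [fset (a + 1 + Posz i)%R | i in iota 0 q]%fset.
have <- : #|` B| = q.
  rewrite card_in_imfset /=; last by move=> i j _ _ /addrI[].
  by rewrite undup_id ?iota_uniq // size_iota.
apply: fsubset_leq_card; apply/fsubsetP => x /imfsetP[i /=].
by rewrite mem_iota => iq ->; apply: hA; lia.
Qed.

Lemma intr_modz {R : nzRingType} (q : nat) (z : int) :
  q%:R = 0 :> R -> (z %% q)%Z%:~R = z%:~R :> R.
Proof.
move=> q0; rewrite [in RHS](divz_eq z q) [RHS]intrD intrM.
by rewrite -[q%:Z%:~R]/(q%:R) q0 mulr0 add0r.
Qed.

Lemma F_le_G (q : nat) : (1 < q)%N -> (F k q <= G k q)%N.
Proof.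
move=> q1; have [A [a hA] ->] := G_attained q.
apply: leq_trans _ (card_ksumset_morph (@intmul 'Z_q 1) k A _ (intrD _)) => //.
apply: F_le => x.
(* the representative of x in ]a, a + q] *)
pose y := a + 1 + ((x%:Z - (a + 1)) %% q)%Z.
have q0 : q%:Z != 0 by lia.
have /hA/imfset2P[b bA [c cA ybc]] : a + 1 <= y <= a + q%:Z.
  have := modz_ge0 (x%:Z - (a + 1)) q0.
  by have := ltz_pmod (x%:Z - (a + 1)) (_ : 0 < q%:Z); rewrite /y; lia.
have -> : x = y%:~R.
  rewrite /y intrD intr_modz ?pchar_Zp // -intrD addrC subrK.
  by rewrite -pmulrn natr_Zp.
rewrite ybc rmorphB; apply/imfset2P; exists b%:~R; first by apply/imfsetP; exists b.
by exists c%:~R => //; apply/imfsetP; exists c.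
Qed.

Lemma G_mono (p q : nat) : (p <= q)%N -> (G k p <= G k q)%N.
Proof.
move=> pq; have [A [a hA] ->] := G_attained q; apply: G_le.
by exists a => x xa; apply: hA; lia.
Qed.

Lemma G_le_F (q : nat) : (1 < q)%N -> (G k q <= k.*2.+1 * F k q)%N.
Proof.
move=> q1; have [A hA ->] := F_attained q.
pose lift (s : 'Z_q) (i : nat) : int := s%:Z + q%:Z * i%:Z.
pose A' := [fset lift a i | a in A, i in iota 0 2]%fset.
have Zq (a : 'Z_q) : (a < q)%N by have := ltn_ord a; rewrite [X in (_ < X)%N]Zp_cast.
have vas (a s : 'Z_q) : (a + s)%R = ((a + s)%N %% q)%N :> nat.
  by rewrite /= [X in (_ %% X)%N]Zp_cast.
(* A sum of n lifts reduces to an element of nA, up to a multiple i of q. Each summand raises i by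
   at most 2: one for its own index and one for the carry of the addition modulo q. Hence i takes at
   most 2n + 1 values. *)
have sub n y : y \in ksumset n A' ->
    exists s i, [/\ s \in ksumset n A, (i < n.*2.+1)%N & y = lift s i].
  elim: n y => [|n IH] y.
    by rewrite inE => /eqP ->; exists 0, 0%N; rewrite inE /lift mulr0.
  case/imfset2P => _ /imfset2P[a aA [e eI ->]] [_ /IH[s [i [sA iI ->]]] ->].
  exists (a + s), (e + i + (a + s) %/ q)%N; split.
  - by apply/imfset2P; exists a => //; exists s.
  - have {eI} : (e < 2)%N by move: eI; rewrite !inE; lia.
    have : ((a + s) %/ q < 2)%N by rewrite ltn_divLR; have := Zq a; have := Zq s; lia.
    lia.
  - by rewrite /lift vas; have := divn_eq (a + s) q; nia.
have hA' : covers_interval q A'.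
  exists (-1) => x hx.
  have [r rx] : exists r : 'Z_q, x = r%:Z.
    have xq : (`|x| < (Zp_trunc q).+2)%N by rewrite Zp_cast; lia.
    by exists (Ordinal xq) => /=; lia.
  have /imfset2P[a aA [b bA rab]] := hA r.
  (* Since r + b = a modulo q, the integers satisfy r + b = a + q e with a carry e in {0, 1}, so r
     is the difference of a + q e and b. *)
  have := vas r b; rewrite {1}rab subrK => ab.
  have : ((r + b) %/ q < 2)%N by rewrite ltn_divLR; have := Zq r; have := Zq b; lia.
  have := divn_eq (r + b) q; set e := ((r + b) %/ q)%N => re e2.
  apply/imfset2P; exists (lift a e).
    by apply/imfset2P; exists a => //; exists e => //; rewrite mem_iota.
  exists (lift b 0%N); first by apply/imfset2P; exists b => //; exists 0%N.
  by rewrite /lift rx; nia.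
apply: leq_trans (G_le _ _ hA') _.
rewrite -(size_iota 0 k.*2.+1) mulnC -(size_allpairs lift).
apply: card_fset_leq_size => y /sub[s [i [sA ik ->]]].
by apply: allpairs_f; rewrite ?mem_iota.
Qed.

(** Expansion in base p: differences of A supply the digit modulo p, and differences of B, dilated
    by p, supply the quotient. *)
Lemma G_mul (p q : nat) : (0 < p)%N -> (G k (p * q) <= G k p * G k q)%N.
Proof.
move=> p0; have [A [a hA] ->] := G_attained p; have [B [b hB] ->] := G_attained q.
pose B' := [fset p%:Z * y | y in B]%fset.
apply: leq_trans _ (leq_mul (leqnn _)
  (card_ksumset_morph ( *%R p%:Z) k B (mulr0 _) (mulrDr _))).
apply: leq_trans _ (card_ksumset_sumset k A B'); apply: G_le.
(* This offset makes x = (a + 1 + r) + p (b + 1 + s) with 0 <= r < p and 0 <= s < q. *)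
exists (a + p%:Z * (b + 1)) => x hx.
pose z := x - (a + p%:Z * (b + 1)) - 1.
have pz : p%:Z != 0 by lia.
have := divz_eq z p; have := modz_ge0 z pz; have := ltz_pmod z (_ : 0 < p%:Z).
set r := (z %% p)%Z; set s := (z %/ p)%Z => /(_ p0) rp r0 zrs.
have /hA/imfset2P[a1 a1A [a2 a2A ea]] : a + 1 <= a + 1 + r <= a + p%:Z by lia.
have /hB/imfset2P[b1 b1B [b2 b2B eb]] : b + 1 <= b + 1 + s <= b + q%:Z.
  by rewrite /z in zrs; nia.
apply/imfset2P; exists (a1 + p%:Z * b1).
  apply/imfset2P; exists a1 => //; exists (p%:Z * b1) => //.
  by apply/imfsetP; exists b1.
exists (a2 + p%:Z * b2); last by rewrite /z in zrs; nia.
apply/imfset2P; exists a2 => //; exists (p%:Z * b2) => //.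
by apply/imfsetP; exists b2.
Qed.

Lemma fset_int_bounded (A : {fset int}) :
  exists n : nat, forall x, x \in A -> (`|x| <= n)%N.
Proof.
exists (\sum_(x <- A) `|x|%N)%N => x xA.
by rewrite (big_fsetD1 x) //= leq_addr.
Qed.

Lemma H_mul (p q : nat) : (H k (p * q) <= H k p * H k q)%N.
Proof.
have [A hA ->] := H_attained p; have [B hB ->] := H_attained q.
have [n hn] := fset_int_bounded (diffset A A).
(* Elements of A - A lie in [-n, n], so two of them differ by at most 2n < c. Thus x + c y
   determines both x in A - A and y. *)
pose c : int := n.*2.+1.
pose B' := [fset c * y | y in B]%fset.
apply: leq_trans _ (leq_mul (leqnn _)
  (card_ksumset_morph ( *%R c) k B (mulr0 _) (mulrDr _))).
apply: leq_trans _ (card_ksumset_sumset k A B'); apply: H_le.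
apply: leq_trans (leq_mul hA hB) _.
rewrite -(size_allpairs (fun x y => x + c * y)).
apply: uniq_leq_size.
  rewrite allpairs_uniq ?fset_uniq // => z z'.
  case/allpairsP => -[x y] [/= /hn xn _ ->].
  case/allpairsP => -[x' y'] [/= /hn xn' _ ->].
  rewrite /c /= => e; have yy' : y = y'.
    have n0 : 0 <= n%:Z by [].
    case: (ltgtP y y') => // yy.
      by have := mulr_ge0 n0 (_ : 0 <= y' - y - 1); lia.
    by have := mulr_ge0 n0 (_ : 0 <= y - y' - 1); lia.
  by rewrite yy' in e *; move/addIr: e => ->.
move=> z /allpairsP[[x y] [/= /imfset2P[a aA [a' aA' ->]]]].
move=> /imfset2P[b bA [b' bA' ->]] ->.
apply/imfset2P; exists (a + c * b).
  apply/imfset2P; exists a => //; exists (c * b) => //.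
  by apply/imfsetP; exists b.
exists (a' + c * b'); last by rewrite mulrBr opprD addrACA.
apply/imfset2P; exists a' => //; exists (c * b') => //.
by apply/imfsetP; exists b'.
Qed.

End Comparisons.

(** * Covering a finite group by few translates of a set *)

Definition translate {V : finZmodType} (D : {set V}) (t : V) : {set V} :=
  [set x | (x - t)%R \in D]%SET.

(** Double counting: a fixed u lies in D + t for exactly |D| values of t, namely t = u - d with d in
    D. *)
Lemma sum_card_translate {V : finZmodType} (D U : {set V}) :
  (\sum_t #|U :&: translate D t| = #|U| * #|D|)%N.
Proof.
have tr t : #|U :&: translate D t| = (\sum_(u in U) (u - t \in D)%R)%N.
  rewrite -sum1_card big_mkcond [RHS]big_mkcond; apply: eq_bigr => u _.
  by rewrite !inE; case: (u \in U) => //=; case: (_ \in D).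
rewrite (eq_bigr _ (fun t _ => tr t)) exchange_big /= -sum_nat_const.
apply: eq_bigr => u _; rewrite -[in RHS]sum1_card [in RHS]big_mkcond /=.
rewrite (reindex_inj (can_inj (subKr u))) /=.
by apply: eq_bigr => t _; rewrite subKr; case: (_ \in D).
Qed.

(** The average of |U :&: (D + t)| over t is |U| |D| / |V| >= |U| / c, and some t reaches the
    average. *)
Lemma exists_good_translate {V : finZmodType} (D U : {set V}) (c : nat) :
  (#|V| <= c * #|D|)%N ->
  exists t, (c * #|U :\: translate D t| <= c.-1 * #|U|)%N.
Proof.
move=> hc.
have [t ht] : exists t, (#|U| <= c * #|U :&: translate D t|)%N.
  apply/existsP; apply: contraT => /existsPn h.
  have : (\sum_(t : V) (c * #|U :&: translate D t|).+1 <= \sum_(t : V) #|U|)%N.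
    by apply: leq_sum => t _; have := h t; lia.
  have sumV n : (\sum_(t : V) n = #|V| * n)%N by rewrite sum_nat_const.
  rewrite (eq_bigr (fun t => c * #|U :&: translate D t| + 1)%N); last first.
    by move=> t _; rewrite addn1.
  rewrite big_split /= -big_distrr /= sum_card_translate !sumV.
  have V0 : (0 < #|V|)%N by apply/card_gt0P; exists 0.
  suff num u d v : (v <= c * d -> 0 < v -> c * (u * d) + v * 1 <= v * u -> False)%N.
    by move=> /(num _ _ _ hc V0).
  by move=> vcd; have := leq_mul (leqnn u) vcd; lia.
exists t; have := cardsID (translate D t) U; nia.
Qed.

(* Greedy covering: some translate of D covers a proportion 1/c of what is
   still uncovered. *)
Lemma exists_covering_translates {V : finZmodType} (D : {set V}) (c j : nat) :
  (#|V| <= c * #|D|)%N -> (#|V| * c.-1 ^ j < c ^ j)%N ->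
  exists2 T : seq V, size T = j &
    forall x, exists2 t, t \in T & (x - t)%R \in D.
Proof.
move=> hc hj.
pose left_over (T : seq V) : {set V} :=
  [set x | all (fun t => (x - t)%R \notin D) T]%SET.
(* The uncovered proportion after j steps is at most ((c - 1) / c)^j, written without denominators.
   By [hj] this leaves less than one element. *)
have [T sT hT] : exists2 T : seq V, size T = j &
    (c ^ j * #|left_over T| <= #|V| * c.-1 ^ j)%N.
  elim: j {hj} => [|j [T sT hT]].
    by exists [::] => //; rewrite !expn0 mul1n muln1 max_card.
  have [t ht] := exists_good_translate D (left_over T) c hc.
  exists (t :: T); first by rewrite /= sT.
  have -> : left_over (t :: T) = left_over T :\: translate D t.
    by apply/setP => x; rewrite !inE.
  rewrite !expnS; nia.
exists T => // x; apply/hasP; rewrite -[has _ _]negbK -all_predC; apply/negP => xT.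
have : (0 < #|left_over T|)%N by apply/card_gt0P; exists x; rewrite inE.
nia.
Qed.

(** * Rounded dilations and their collisions *)

Lemma size_undup_collisions {T U : eqType} (f : T -> U) (s : seq T) : uniq s ->
  (size s <= size (undup [seq f x | x <- s]) +
     \sum_(x <- s) \sum_(y <- s) ((x != y) && (f x == f y)))%N.
Proof.
elim: s => [//|x s IH] /= /andP[xs us].
rewrite big_cons big_cons eqxx /= add0n.
under [X in (_ + (_ + X))%N]eq_bigr do rewrite big_cons.
rewrite big_split /=.
have := IH us.
(* If [f x] recurs in the tail, x adds nothing to the image, but the ordered pair (x, y) with a
   later y pays for it. *)
case: ifP => [/mapP[y ys fxy]|_] /=; last by lia.
rewrite [X in (_ < _ + (X + _))%N](bigD1_seq y) //= fxy eqxx andbT.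
suff -> : x != y by lia.
by apply: contraNneq xs => ->.
Qed.

(** Modulo m, the value tells which of the m arcs of length P / m in the circle of integers modulo P
    contains t x. Leaving it unreduced keeps the map nearly additive on the integers. *)
Definition dilate_floor (P m t : nat) (x : int) : int :=
  ((t%:Z * x * m%:Z) %/ P%:Z)%Z.

Lemma dilate_floorD (P m t : nat) (x y : int) : (0 < P)%N ->
  exists2 e : nat, (e < 2)%N & dilate_floor P m t (x + y) =
    dilate_floor P m t x + dilate_floor P m t y + e%:Z.
Proof.
move=> P0; rewrite /dilate_floor mulrDr mulrDl.
set a := _ * x * _; set b := _ * y * _.
have Pz : P%:Z != 0 by lia.
have := divz_eq a P; have := divz_eq b P; have := divz_eq (a + b) P.
have := modz_ge0 a Pz; have := modz_ge0 b Pz; have := modz_ge0 (a + b) Pz.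
have := ltz_pmod a (_ : 0 < P%:Z); have := ltz_pmod b (_ : 0 < P%:Z).
have := ltz_pmod (a + b) (_ : 0 < P%:Z).
move: (a %/ P)%Z (b %/ P)%Z ((a + b) %/ P)%Z (a %% P)%Z (b %% P)%Z ((a + b) %% P)%Z.
move=> u v w r s z /(_ P0) h1 /(_ P0) h2 /(_ P0) h3 h4 h5 h6 e1 e2 e3.
have e : P%:Z * (w - u - v) = r + s - z by lia.
have h : 0 <= w - u - v <= 1 by apply/andP; split; nia.
by exists `|(w - u - v)%R|%N; lia.
Qed.

Lemma card_ksumset_dilate_floor (P m t k : nat) (A : {fset int}) : (0 < P)%N ->
  (#|` ksumset k [fset dilate_floor P m t a | a in A]%fset|
     <= k.+1 * #|` ksumset k A|)%N.
Proof.
move=> P0; set B := [fset _ | _ in _]%fset; set f := dilate_floor P m t.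
(* The map sends 0 to 0 and each of the n additions costs a rounding error 0 or 1, so the total
   error i is at most n. *)
have sub n y : y \in ksumset n B ->
    exists x i, [/\ x \in ksumset n A, (i < n.+1)%N & y = f x - i%:Z].
  elim: n y => [|n IH] y.
    rewrite inE => /eqP ->; exists 0, 0%N; rewrite inE /f /dilate_floor.
    by rewrite mulr0 mul0r div0z.
  case/imfset2P => _ /imfsetP[a aA ->] [_ /IH[x [i [xA ik ->]]] ->].
  have [e e2 fe] := dilate_floorD P m t a x P0.
  exists (a + x), (e + i)%N; split; last by rewrite /f fe; lia.
    by apply/imfset2P; exists a => //; exists x.
  by lia.
rewrite -(size_iota 0 k.+1) mulnC -(size_allpairs (fun x i => f x - i%:Z)).
apply: card_fset_leq_size => y /sub[x [i [xA ik ->]]].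
by apply: (allpairs_f (fun x i => f x - i%:Z)); rewrite ?mem_iota.
Qed.

(** If the two floors differ by m z, then m (t (x - y) - P z) is a difference of two remainders
    modulo P, so its absolute value is below P. *)
Lemma dilate_floor_collision (P m t : nat) (x y : int) : (0 < P)%N -> (0 < m)%N ->
  (m%:Z %| (dilate_floor P m t x - dilate_floor P m t y)%R)%Z ->
  exists w z : int, [/\ t%:Z * (x - y) = P%:Z * z + w & (`|w| <= P %/ m)%N].
Proof.
move=> P0 m0 /dvdzP[z]; rewrite /dilate_floor.
set a := _ * x * _; set b := _ * y * _.
have Pz : P%:Z != 0 by lia.
have := divz_eq a P; have := divz_eq b P.
have := modz_ge0 a Pz; have := modz_ge0 b Pz.
have := ltz_pmod a (_ : 0 < P%:Z); have := ltz_pmod b (_ : 0 < P%:Z).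
move: (a %/ P)%Z (b %/ P)%Z (a %% P)%Z (b %% P)%Z.
move=> u v r s /(_ P0) h1 /(_ P0) h2 h3 h4 e1 e2 e3.
exists (t%:Z * (x - y) - P%:Z * z), z; split; first lia.
rewrite leq_divRL //.
have : (t%:Z * (x - y) - P%:Z * z) * m%:Z = r - s.
  by rewrite /a /b in e1 e2; nia.
by move: (_ - _ * z) => w; nia.
Qed.

Lemma sum_seq_leq {T : eqType} (s : seq T) (f : T -> nat) (c : nat) :
  (forall x, x \in s -> (f x <= c)%N) -> (\sum_(x <- s) f x <= size s * c)%N.
Proof.
move=> fc; rewrite mulnC -iter_addn_0 -count_predT -big_const_seq.
by rewrite big_seq [X in (_ <= X)%N]big_seq; apply: leq_sum.
Qed.

(* For a prime P not dividing x - y, the residue of t (x - y) mod P determines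
   t, and a collision confines it to an interval of length 2 P / m. *)
Lemma dilate_floor_collision_count (P m : nat) (x y : int) : prime P ->
  (0 < m <= P)%N -> (0 < `|(x - y)%R| < P)%N ->
  (m * \sum_(t < P)
      (m%:Z %| (dilate_floor P m t x - dilate_floor P m t y)%R)%Z <= 3 * P)%N.
Proof.
move=> pP mP xyP; have P0 := prime_gt0 pP; have Pz : P%:Z != 0 by lia.
rewrite [X in (_ * X)%N](_ : _ = #|[pred t : 'I_P |
    (m%:Z %| (dilate_floor P m t x - dilate_floor P m t y)%R)%Z]|); last first.
  by rewrite -sum1_card [RHS]big_mkcond; apply: eq_bigr => t _; rewrite inE; case: ifP.
set N := (P %/ m)%N; have mN : (m * N <= P)%N by rewrite mulnC leq_divM.
(* With N <= P / m and m <= P, one gets m (2N + 1) <= 2P + m <= 3P. *)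
suff : (#|[pred t : 'I_P | (m%:Z %| (dilate_floor P m t x
    - dilate_floor P m t y)%R)%Z]| <= N.*2.+1)%N.
  nia.
have m0 : (0 < m)%N by lia.
(* The shift by N moves the possible residues from [-N, N] to [0, 2N]. *)
pose g (t : 'I_P) : nat := `|((t%:Z * (x - y) + N%:Z)%R %% P)%Z|%N.
rewrite cardE -(size_map g) -(size_iota 0 N.*2.+1).
apply: uniq_leq_size.
  rewrite map_inj_uniq ?enum_uniq // => t t' gtt.
  have : (t%:Z * (x - y) + N%:Z == t'%:Z * (x - y) + N%:Z %[mod P])%Z.
    move: gtt; rewrite /g.
    have := modz_ge0 (t%:Z * (x - y) + N%:Z) Pz.
    by have := modz_ge0 (t'%:Z * (x - y) + N%:Z) Pz; lia.
  rewrite eqz_modDr eqz_mod_dvd -mulrBl Gauss_dvdzl; last first.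
    by rewrite coprimezE /= prime_coprime // gtnNdvd; lia.
  move=> /dvdzP[z zt]; apply/val_inj => /=.
  move: (nat_of_ord t) (nat_of_ord t') (ltn_ord t) (ltn_ord t') zt => u u' uP u'P zt.
  by case: (ltgtP z 0) => [z0|z0|z0]; nia.
move=> u /mapP[t]; rewrite mem_enum inE.
move=> /(dilate_floor_collision _ _ _ _ _ P0 m0)[w [z [e wN]]] ->.
rewrite mem_iota /g e -addrA mulrC modzMDl.
rewrite -[(w + N%:Z)%R]gez0_abs ?modz_nat; last lia.
by have := leq_mod `|(w + N%:Z)%R| P; lia.
Qed.

(** First moment over t: at most q^2 ordered pairs each collide for a proportion at most 3 / m of
    the t. The modulus m = 6 q brings the average number of collisions down to q / 2. *)
Lemma exists_good_dilation (q : nat) (s : seq int) : (0 < q)%N -> uniq s ->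
  size s = q -> exists P t : nat, (0 < P)%N /\
  (q <= 2 * size (undup [seq (dilate_floor P (6 * q) t x)%:~R : 'Z_(6 * q) | x <- s]))%N.
Proof.
move=> q0 us sq; set m := (6 * q)%N.
have [n hn] : exists n : nat, forall x, x \in s -> (`|x| <= n)%N.
  have [n hn] := fset_int_bounded [fset x in s]%fset.
  by exists n => x xs; apply: hn; rewrite inE.
(* The prime exceeds m and every |x - y| with x, y in s, as [dilate_floor_collision_count]
   requires. *)
have [P nP pP] := prime_above (n + n + m).
have P0 := prime_gt0 pP.
pose f t x : 'Z_m := (dilate_floor P m t x)%:~R.
pose im t := size (undup [seq f t x | x <- s]).
pose coll t x y := (m%:Z %| (dilate_floor P m t x - dilate_floor P m t y)%R)%Z.
pose colls t := (\sum_(x <- s) \sum_(y <- s) ((x != y) && coll t x y))%N.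
have fcoll t x y : f t x = f t y -> coll t x y.
  move=> /eqP; rewrite -subr_eq0 -intrB => /eqP e; rewrite /coll.
  have m1 : (1 < m)%N by lia.
  apply/dvdz_mod0P; set z := _ - _ in e *.
  have : (z %% m)%Z%:~R = 0 :> 'Z_m by rewrite intr_modz // pchar_Zp.
  have : 0 <= (z %% m)%Z < m%:Z by rewrite modz_ge0 ?ltz_pmod; lia.
  case: (z %% m)%Z => // r /= rm /(congr1 (@nat_of_ord _)).
  rewrite -[r%:Z%:~R]/(r%:R) val_Zp_nat // modn_small; last lia.
  by move=> /= ->.
suff [t ht] : exists t, (q <= 2 * im t)%N.
  by exists P, t.
apply: contrapT => /forallNP h.
(* An image of size below q / 2 forces more than q / 2 collisions; if this held for every t it would
   contradict [total]. *)
have step t : (q.+1 <= 2 * colls t)%N.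
  have /negP := h t; rewrite -ltnNge => ht.
  have hs : (q <= im t + \sum_(x <- s) \sum_(y <- s) ((x != y) && (f t x == f t y)))%N.
    by rewrite -sq; exact: size_undup_collisions.
  suff : (\sum_(x <- s) \sum_(y <- s) ((x != y) && (f t x == f t y)) <= colls t)%N.
    lia.
  apply: leq_sum => x _; apply: leq_sum => y _.
  by case: (x != y) => //=; case: eqP => // /fcoll ->.
have total : (m * \sum_(t < P) colls t <= q * (q * (3 * P)))%N.
  rewrite exchange_big /= big_distrr /= -{1}sq; apply: sum_seq_leq => x xs.
  rewrite exchange_big /= big_distrr /= -{1}sq; apply: sum_seq_leq => y ys.
  have [->|xy] /= := eqVneq x y; first by rewrite big1 ?muln0.
  apply: dilate_floor_collision_count => //; first lia.
  by have := hn _ xs; have := hn _ ys; lia.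
have : (\sum_(t < P) q.+1 <= \sum_(t < P) 2 * colls t)%N.
  by apply: leq_sum => t _; apply: step.
rewrite sum_nat_const card_ord -big_distrr /= => h1.
have : (m * (P * q.+1) <= 2 * (q * (q * (3 * P))))%N.
  apply: (leq_trans (n := (m * (2 * \sum_(t < P) colls t))%N)).
    by rewrite leq_mul2l h1 orbT.
  by rewrite mulnCA leq_mul2l total orbT.
have -> : (2 * (q * (q * (3 * P))) = m * (P * q))%N by rewrite /m; lia.
by rewrite !leq_mul2l /m; lia.
Qed.

(** * Bounding [F] and [G] by [H] *)

Lemma F_le_H (k q j : nat) : (0 < q)%N -> (6 * q * 11 ^ j < 12 ^ j)%N ->
  (F k (6 * q) <= k.+1 * j.*2.+1 ^ k * H k q)%N.
Proof.
move=> q0 hj; have [A hA ->] := H_attained k q.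
have us : uniq (take q (diffset A A)) by rewrite take_uniq ?fset_uniq.
have ss : size (take q (diffset A A)) = q by rewrite size_takel.
have [P [t [P0]]] := exists_good_dilation q _ q0 us ss.
set m := (6 * q)%N; set f := dilate_floor P m t; set s := undup _ => hs.
pose D : {set 'Z_m} := [set x in s]%SET.
have cD : #|D| = size s.
  by rewrite cardsE; apply/card_uniqP/undup_uniq.
have cZ : #|{: 'Z_m}| = m by rewrite card_ord Zp_cast // /m; lia.
(* The constant 12: the image D of q differences has at least q / 2 = m / 12 residues. *)
have [||T sT hT] := @exists_covering_translates 'Z_m D 12 j.
- by rewrite cZ cD; have : m = (6 * q)%N := erefl; lia.
- by rewrite cZ.
(* Write x = f (a - b) + y with y in T, and f a = f (a - b) + f b + e. Then x = (f a + (y - e)) - (f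
   b + 0), so S needs 0, T and T - 1, at most 2j + 1 elements. *)
pose S := [fset x in 0 :: T ++ [seq y - 1 | y <- T]]%fset.
have cS : (#|` S| <= j.*2.+1)%N.
  apply: (leq_trans (card_fset_leq_size S (0 :: T ++ [seq y - 1 | y <- T]) _)).
    by move=> x /imfsetP[y /= yT ->].
  by rewrite /= size_cat size_map sT addnn.
pose B := [fset f a | a in A]%fset.
pose C := [fset (b%:~R : 'Z_m) | b in B]%fset.
have CS (a : int) y : a \in A -> y \in S -> (f a)%:~R + y \in sumset C S.
  move=> aA yS; apply/imfset2P; exists (f a)%:~R; last by exists y.
  by apply/imfsetP; exists (f a) => //; apply/imfsetP; exists a.
apply: leq_trans (F_le k m (sumset C S) _) _ => [x|].
  have [y yT] := hT x; rewrite inE mem_undup => /mapP[d /mem_take].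
  case/imfset2P => a aA [b bA ->] xy.
  have [e e2 fe] := dilate_floorD P m t (a - b) b P0.
  rewrite subrK in fe.
  apply/imfset2P; exists ((f a)%:~R + (y - e%:R)).
    apply: CS => //; apply/imfsetP; exists (y - e%:R) => //=; rewrite inE mem_cat.
    apply/orP; right.
    case: e e2 {fe} => [|[|//]] _; first by rewrite subr0 yT.
    by apply/orP; right; apply/mapP; exists y.
  exists ((f b)%:~R + 0); first by apply: CS => //; rewrite !inE eqxx.
  rewrite /f fe !intrD addr0 -[x](subrK y) xy -pmulrn.
  by ring.
apply: leq_trans (card_ksumset_sumset k C S) _.
rewrite mulnAC leq_mul //.
  apply: leq_trans (card_ksumset_morph (@intmul 'Z_m 1) k B _ (intrD _)) _ => //.
  exact: card_ksumset_dilate_floor.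
apply: leq_trans (card_ksumset_leq k S) _.
by case: (posnP k) => [->|k0]; rewrite ?expn0 ?leq_exp2r.
Qed.

Lemma G_exp (k q n : nat) : (1 < q)%N -> (G k (q ^ n.+1) <= G k q ^ n.+1)%N.
Proof.
move=> q1; elim: n => [|n IH]; first by rewrite !expn1.
rewrite expnS [leqRHS]expnS.
by rewrite (leq_trans (G_mul _ _ _ _)) ?leq_mul2l ?IH ?orbT //; lia.
Qed.

Lemma H_exp (k q n : nat) : (H k (q ^ n.+1) <= H k q ^ n.+1)%N.
Proof.
elim: n => [|n IH]; first by rewrite !expn1.
rewrite expnS [leqRHS]expnS.
by rewrite (leq_trans (H_mul _ _ _)) ?leq_mul2l ?IH ?orbT.
Qed.

(** For fixed k and q the loss is only polynomial in n, hence negligible against the n-th power. *)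
Lemma G_exp_le_H (k q n : nat) : (1 < q)%N -> (0 < n)%N ->
  (G k (q ^ n) <= k.*2.+1 * k.+1 * (65 * q * n) ^ k * H k q ^ n)%N.
Proof.
case: n => // n q1 _; set Q := (q ^ n.+1)%N.
have Q0 : (0 < Q)%N by rewrite expn_gt0; lia.
(* Here 6 Q < 2^L because q <= 2^q and 6 < 2^3. As 2 * 11^8 <= 12^8, the choice j = 8 L gives (12 /
   11)^j >= 2^L. Finally 2j + 1 = 16 q (n + 1) + 49 <= 65 q (n + 1). *)
pose L := (q * n.+1 + 3)%N; pose j := (8 * L)%N.
have hj : (6 * Q * 11 ^ j < 12 ^ j)%N.
  have QL : (6 * Q < 2 ^ L)%N.
    have : (Q <= 2 ^ (q * n.+1))%N.
      by rewrite expnM leq_exp2r // ltnW // ltn_expl.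
    by rewrite expnD; lia.
  apply: (leq_trans (n := (2 ^ L * 11 ^ j)%N)).
    by rewrite ltn_pmul2r // expn_gt0.
  have : (2 * 11 ^ 8 <= 12 ^ 8)%N by lia.
  rewrite /j !expnM; move: (11 ^ 8)%N (12 ^ 8)%N => a b ab.
  by rewrite -expnMn leq_exp2r // /L addn3.
have := F_le_H k Q j Q0 hj.
have := G_le_F k (6 * Q) (_ : 1 < 6 * Q)%N.
have := G_mono k Q (6 * Q) (leq_pmull _ _).
have := H_exp k q n.
have : (j.*2.+1 ^ k <= (65 * q * n.+1) ^ k)%N.
  case: (k) => // k'; rewrite leq_exp2r // /j /L; nia.
move=> h1 h2 /(_ isT) h3 /(_ (ltac:(lia))) h4 h5.
apply: (leq_trans h3); apply: (leq_trans h4); rewrite -!mulnA leq_mul2l /=.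
apply: (leq_trans h5); rewrite -mulnA leq_mul2l /=.
by rewrite -!mulnA in h1; exact: leq_mul h1 h2.
Qed.

(** * Logarithmic asymptotics *)

Section Asymptotics.
Context {R : realType}.

Lemma ln_nat_ge0 (a : nat) : 0 <= ln (a%:R : R).
Proof. by case: a => [|a]; [rewrite ln0 | rewrite ln_ge0 // ler1n]. Qed.

Lemma ler_ln_nat (a b : nat) : (a <= b)%N -> ln (a%:R : R) <= ln b%:R.
Proof.
case: a => [|a] ab; first by rewrite ln0 // ln_nat_ge0.
by rewrite ler_ln ?posrE ?ltr0n ?ler_nat //; lia.
Qed.

Lemma ln_nat_gt0 (a : nat) : (1 < a)%N -> 0 < ln (a%:R : R).
Proof. by move=> a1; rewrite ln_gt0 // ltr1n. Qed.

Lemma ler_ln_natM (a b : nat) : ln ((a * b)%:R : R) <= ln a%:R + ln b%:R.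
Proof.
case: (posnP a) => [->|a0]; first by rewrite ln0 // add0r ln_nat_ge0.
case: (posnP b) => [->|b0]; first by rewrite muln0 ln0 // addr0 ln_nat_ge0.
by rewrite natrM lnM ?posrE ?ltr0n.
Qed.

Lemma ler_ln_natX (a n : nat) : ln ((a ^ n)%:R : R) <= n%:R * ln a%:R.
Proof.
elim: n => [|n IH]; first by rewrite expn0 ln1 mul0r.
by rewrite expnS (le_trans (ler_ln_natM _ _)) // -natr1 mulrDl mul1r addrC lerD2r.
Qed.

Lemma near_ler_ln_nat (c : R) : \forall n \near \oo, c <= ln (n%:R : R).
Proof.
have [N hN] : exists N : nat, expR c <= N%:R.
  by exists (Num.bound (expR c)); apply/ltW/archi_boundP/expR_ge0.
exists N => // n /= Nn; rewrite -[c]expRK ler_ln ?posrE ?expR_gt0 //.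
  by rewrite (le_trans hN) // ler_nat.
by rewrite (lt_le_trans (expR_gt0 c)) // (le_trans hN) // ler_nat.
Qed.

Lemma cvg_of_near_bounds (u : nat -> R) (l : R) :
  (forall e, 0 < e -> \forall n \near \oo, l - e <= u n <= l + e) ->
  u n @[n --> \oo] --> l.
Proof.
move=> h; apply/cvgrPdist_le => e e0.
by apply: filterS (h e e0) => n; rewrite ler_distlC.
Qed.

Lemma inflogratio_le (f : nat -> nat) (q : nat) : (1 < q)%N ->
  inflogratio R f <= logratio R f q.
Proof. by move=> q1; apply: ge_inf; [case: (has_inf_logratio R f) | exists q]. Qed.

Lemma alpha_ln_le (k q : nat) : (1 < q)%N ->
  alpha R k * ln q%:R <= ln (G k q)%:R.
Proof. by move=> q1; rewrite -ler_pdivlMr ?ln_nat_gt0 //; apply: inflogratio_le. Qed.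

Lemma linear_ge_square_le0 (x c : R) :
  (forall s : nat, (0 < s)%N -> s%:R ^+ 2 * x <= c * s%:R) -> x <= 0.
Proof.
move=> h; rewrite leNgt; apply/negP => x0.
pose s := (Num.bound `|c / x|).+1.
have := h s isT; rewrite expr2 -mulrA mulrC ler_pM2r ?ltr0n // -ler_pdivlMr // leNgt.
move/negP; apply; rewrite (le_lt_trans (ler_norm _)) //.
by rewrite (lt_trans (archi_boundP (normr_ge0 _))) // ltr_nat.
Qed.

(** Power trick: at q^(s^2) the main terms scale like s^2. The logarithm of the loss contains s only
    through 2 k ln s <= 2 k s, so it is at most linear in s and vanishes after division by s^2. The
    square exponent lets the crude bound ln s <= s suffice. *)
Lemma alpha_ln_le_H (k q : nat) : (1 < q)%N ->
  alpha R k * ln q%:R <= ln (H k q)%:R.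
Proof.
move=> q1; rewrite -subr_le0.
pose C : R := ln (k.*2.+1 * k.+1)%:R + k%:R * ln (65 * q)%:R.
have C0 : 0 <= C by rewrite addr_ge0 ?mulr_ge0 ?ln_nat_ge0.
apply: (@linear_ge_square_le0 _ (C + 2 * k%:R)) => s s0.
have n0 : (0 < s ^ 2)%N by rewrite expn_gt0 s0.
have Q1 : (1 < q ^ (s ^ 2))%N by rewrite -[X in (X < _)%N](exp1n (s ^ 2)) ltn_exp2r.
have lnQ : ln ((q ^ (s ^ 2))%:R : R) = s%:R ^+ 2 * ln q%:R.
  by rewrite natrX lnXn ?ltr0n 1?ltnW // -natrX mulr_natl.
have h1 := alpha_ln_le k _ Q1; rewrite lnQ in h1.
have h2 := ler_ln_nat _ _ (G_exp_le_H k q (s ^ 2) q1 n0).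
have h3 := ler_ln_natM (k.*2.+1 * k.+1 * (65 * q * s ^ 2) ^ k) (H k q ^ (s ^ 2)).
have h4 := ler_ln_natM (k.*2.+1 * k.+1) ((65 * q * s ^ 2) ^ k).
have h5 := ler_ln_natX (65 * q * s ^ 2) k.
have h6 := ler_ln_natM (65 * q) (s ^ 2).
have h7 := ler_ln_natX s 2.
have h8 := ler_ln_natX (H k q) (s ^ 2); rewrite (natrX _ s) in h8.
have h9 : ln (s%:R : R) <= s%:R.
  have e : s%:R = 1 + (s%:R - 1) :> R by rewrite addrC subrK.
  rewrite {1}e.
  apply: le_trans (le_ln1Dx _) _; last by rewrite gerBl.
  by rewrite ltrBrDl subrr ltr0n.
have s1 : 1 <= s%:R :> R by rewrite ler1n.
have Cs : C <= C * s%:R by rewrite ler_peMr.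
have k0 : 0 <= k%:R :> R by [].
have h10 : k%:R * ln (65 * q * s ^ 2)%:R <= k%:R * (ln (65 * q)%:R + 2 * s%:R) :> R.
  by apply: ler_wpM2l => //; lra.
rewrite /C in Cs *; lra.
Qed.

(** Fekete's argument: take q whose ratio is within e / 2 of the infimum, and compare n with the
    powers q^i <= n < q^(i+1) by monotonicity and submultiplicativity. *)
Lemma near_logratio_G_le (k : nat) (e : R) : 0 < e ->
  \forall n \near \oo, logratio R (G k) n <= alpha R k + e.
Proof.
move=> e0.
have [_ [q q1 <-] hq] :=
  inf_adherent (divr_gt0 e0 (ltr0Sn R 1)) (has_inf_logratio R (G k)).
set r := logratio _ _ _ in hq; rewrite -/(inflogratio R (G k)) -/(alpha R k) in hq.
have r0 : 0 <= r by rewrite divr_ge0 ?ln_nat_ge0.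
near=> n.
have n1 : (1 < n)%N by near: n; exists 2%N.
have ln_n := ln_nat_gt0 _ n1.
rewrite ler_pdivrMr //.
have /andP[qn nq] : (q ^ trunc_log q n <= n < q ^ (trunc_log q n).+1)%N.
  by apply: trunc_log_bounds => //; apply: ltnW.
move: (trunc_log q n) qn nq => i qn nq.
have h1 := ler_ln_nat _ _ (leq_trans (G_mono k _ _ (ltnW nq)) (G_exp k q i q1)).
have h2 := ler_ln_natX (G k q) i.+1.
have h3 := ler_ln_nat _ _ qn.
have h4 : ln (q ^ i)%:R = i%:R * ln q%:R :> R.
  by rewrite natrX lnXn ?ltr0n 1?ltnW // mulr_natl.
have h5 : ln (G k q)%:R = r * ln q%:R.
  by rewrite /r divfK // gt_eqF // ln_nat_gt0.
(* Rounding the exponent up to i + 1 costs one factor [G k q], independent of n; for large n its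
   logarithm is at most (e / 2) ln n. *)
have h6 : 2 / e * ln (G k q)%:R <= ln n%:R by near: n; apply: near_ler_ln_nat.
have h7 : r * (i%:R * ln q%:R) <= r * ln n%:R by rewrite ler_wpM2l // -h4.
have h8 : r * ln n%:R <= (alpha R k + e / 2) * ln n%:R by rewrite ler_pM2r // ltW.
have h9 : ln (G k q)%:R <= e / 2 * ln n%:R.
  by rewrite -ler_pdivrMl ?divr_gt0 // invf_div.
rewrite -natr1 mulrDl mul1r {1}h5 in h2.
lra.
Unshelve. all: by end_near. Qed.

End Asymptotics.

Theorem theorem1 (R : realType) (k : nat) (hk : (0 < k)%N) :
  [/\ logratio R (F k) q @[q --> \oo] --> alpha R k,
      logratio R (G k) q @[q --> \oo] --> alpha R k,
      logratio R (H k) q @[q --> \oo] --> alpha R k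
    & inflogratio R (H k) = alpha R k].
Proof.
have near1 : \forall n \near \oo, (1 < n)%N by exists 2%N.
have alpha_le_H q : (1 < q)%N -> alpha R k <= logratio R (H k) q.
  by move=> q1; rewrite ler_pdivlMr ?ln_nat_gt0 //; apply: alpha_ln_le_H.
have ratio_H_le_G q : (1 < q)%N -> logratio R (H k) q <= logratio R (G k) q.
  move=> q1; rewrite ler_pM2r ?invr_gt0 ?ln_nat_gt0 //.
  exact/ler_ln_nat/H_le_G.
have ratio_F_le_G q : (1 < q)%N -> logratio R (F k) q <= logratio R (G k) q.
  move=> q1; rewrite ler_pM2r ?invr_gt0 ?ln_nat_gt0 //.
  exact/ler_ln_nat/F_le_G.
split.
- apply: cvg_of_near_bounds => e e0; near=> n.
  have n1 : (1 < n)%N by near: n.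
  apply/andP; split; last first.
    by apply: le_trans (ratio_F_le_G n n1) _; near: n; apply: near_logratio_G_le.
  have ln_n : 0 < ln (n%:R : R) by apply: ln_nat_gt0.
  rewrite ler_pdivlMr //.
  (* The lower bound for [F] comes from that for [G]; the factor 2k + 1 costs at most e ln n for
     large n. *)
  have h1 := @ler_ln_nat R _ _ (G_le_F k n n1).
  have h2 := @ler_ln_natM R k.*2.+1 (F k n).
  have h3 := @alpha_ln_le R k n n1.
  have h4 : ln (k.*2.+1)%:R / e <= ln n%:R :> R by near: n; apply: near_ler_ln_nat.
  rewrite ler_pdivrMr // in h4; lra.
- apply: cvg_of_near_bounds => e e0; near=> n.
  have n1 : (1 < n)%N by near: n.
  apply/andP; split; last by near: n; apply: near_logratio_G_le.
  by rewrite lerBlDr (le_trans (inflogratio_le _ _ n1)) // lerDl ltW.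
- apply: cvg_of_near_bounds => e e0; near=> n.
  have n1 : (1 < n)%N by near: n.
  apply/andP; split.
    by rewrite lerBlDr (le_trans (alpha_le_H n n1)) // lerDl ltW.
  by apply: le_trans (ratio_H_le_G n n1) _; near: n; apply: near_logratio_G_le.
- apply/eqP; rewrite eq_le; apply/andP; split.
    apply: lb_le_inf; first by case: (has_inf_logratio R (G k)).
    by move=> _ [q q1 <-]; apply: le_trans (inflogratio_le _ _ q1) (ratio_H_le_G q q1).
  apply: lb_le_inf; first by case: (has_inf_logratio R (H k)).
  by move=> _ [q q1 <-]; apply: alpha_le_H.
Unshelve. all: by end_near. Qed.
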